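(* Let $B=(G,T)$ be a B-ESG grammar and let $B'=(G',T)$ be the result of a B-ESG transformation step applied to $B$ using a string graph rewrite rule $L\leftarrow I\rightarrow R$, modifying a production $p=X\to(D,C)$ to $p'=X\to(D',C)$. Then $(B,B')$, with productions corresponding via $p\leftrightarrow p'$ and identity on all other productions, is a B-ESG rewrite pattern (in particular, $B'$ is a B-ESG grammar).
   Context: Graphs: a graph over $\Sigma,\Gamma$ is $H=(V,E,\lambda)$ with $V$ finite, $E\subseteq\{(v,\gamma,w): v\neq w,\gamma\in\Gamma\}$, $\lambda:V\to\Sigma$. A graph with embedding is $(D,C)$ with $C\subseteq\Sigma\times\Gamma\times\Gamma\times V_D\times\{in,out\}$, elements written $(\sigma,\beta/\gamma,x,d)$; a vertex $x$ ''has connection instructions'' if some element of $C$ has fourth component $x$. An edNCE grammar $G=(\Sigma,\Delta,\Gamma,\Omega,P,S)$ has terminal labels $\Delta$, final edge labels $\Omega$, finitely many productions $X\to(D,C)$ ($X$ non-terminal) and initial non-terminal $S$. Applying $X\to(D,C)$ to an $X$-labelled vertex $v$: delete $v$, add a copy of $D$, and for every $\beta$-edge between $v$ and a $\sigma$-labelled vertex $w$ directed into $v$ ($d=in$) or out of $v$ ($d=out$) and each $(\sigma,\beta/\gamma,x,d)\in C$, add a $\gamma$-edge between $w$ and $x$ ($w\to x$ if $d=in$, $x\to w$ if $d=out$). B-edNCE: production bodies have no adjacent non-terminals and no instruction has non-terminal $\sigma$. String graphs: for disjoint label sets $\mathcal N$ (node-vertices), $\mathcal W$ (wire-vertices), a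 string graph is a directed graph labelled in $\mathcal N\cup\mathcal W$ with no edge between node-vertices and all wire-vertices of in- and out-degree at most one. Inputs/outputs: wire-vertices with no incoming/outgoing edges; boundary = inputs and outputs. Wire-homeomorphism $G\sim G'$: obtained by finitely many mergings of two adjacent wire-vertices or splittings of a wire-vertex into two adjacent ones. A matching of a string graph $L$ with boundary $B_L$ onto a string graph $H$ is an injective label-preserving homomorphism $m:L\to\widetilde H$, $\widetilde H\sim H$, such that every edge joining a vertex of $m(L)$ to a vertex outside it is incident to $m(B_L)$. A string graph rewrite rule is a span $L\leftarrow I\rightarrow R$ with $I$ the common boundary of $L$ and $R$; rewriting along a matching is a double pushout (pushout complement then pushout) in the category of string graphs. Encoded string graph: string graph where edges labelled by encoding symbols $\alpha\in\mathcal E$ may also join node-vertices. Decoding system $T$: for each $(\alpha,N_1,N_2)\in\mathcal E\times\mathcal N\times\mathcal N$ one DPO rule replacing a single $\alpha$-edge from an $N_1$ node-vertex to an $N_2$ node-vertex (interface: the two node-vertices) by a connected string graph with no inputs, outputs or encoding labels. B-ESG grammar $B=(G,T)$: $T$ a decoding system, $G=(\Sigma,\Delta,\Gamma,\Gamma,P,S)$ B-edNCE with $\Delta=\mathcal N\cup\mathcal W$, $\mathcal E\subseteq\Gamma$, and for each production $X\to(D,C)$: (N1) an edge of $D$ has encoding label iff it joins two node-vertices; (N2) instructions $(N,\alpha/\beta,x,d)$ with $N\in\mathcal N$, $x$ a node-vertex have $\beta\in\mathcal E$; (W1) wire-vertices of $D$ have in- and out-degree at most one; (W2) no instruction $(\sigma,\alpha/\beta,x,d)$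 has $x$ a wire-vertex; (W3) for each $W\in\mathcal W,\gamma,d$ at most one instruction $(W,\gamma/\delta,x,d)$, and $\delta\notin\mathcal E$; (W4) if a non-terminal $y$ with label $Y$ in $D$ is adjacent to a $W$-labelled wire-vertex via an edge of direction $d$ and label $\beta$, or there is an instruction $(W,\alpha/\beta,y,d)$, then all productions for $Y$ contain an instruction $(W,\beta/\gamma,z,d)$. B-ESG rewrite pattern: a pair of B-ESG grammars $B_1=(G_1,T)$, $B_2=(G_2,T)$ with $G_i=(\Sigma,\Delta,\Gamma,\Gamma,P_i,S)$, together with a bijective correspondence between $P_1$ and $P_2$ pairing productions with the same left-hand side $X$, such that for each corresponding pair $X\to(D_1,C_1)$, $X\to(D_2,C_2)$: (NT) there is a label-preserving bijection between the non-terminal vertices of $D_1$ and of $D_2$; (IO) there is a bijection between the inputs (resp. outputs) of $D_1$ and those of $D_2$. Final subgraph: for a production $X\to(D,C)$, a subgraph $S'$ of $D$ is final if $S'$ is a string graph, it is not adjacent to any non-terminal vertex of $D$, and no vertex of $S'$ has connection instructions in $C$. B-ESG transformation step: $B=(G,T)$ is transformed into $B'=(G',T)$ using a string graph rewrite rule $L\leftarrow I\rightarrow R$ if (1) some production $p=X\to(D,C)$ of $G$ admits a matching of $L$ into a final subgraph of $D$, and (2) $G'$ has the same productions as $G$ except that $p$ is replaced by $p'=X\to(D',C)$, where $D'$ is the result of applying the rewrite rule to $D$ at that matching. *)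

(* Defs.v *)
From mathcomp Require Import all_boot.
From Stdlib Require Import Relation_Operators.

Set Implicit Arguments.
Unset Strict Implicit.
Unset Printing Implicit Defensive.

Record alphabet := Alphabet {
  Sigma : finType;
  Gamma : finType;
  nodeL : {set Sigma};
  wireL : {set Sigma};
  encL  : {set Gamma};
  nodeL_wireL_disjoint : [disjoint nodeL & wireL]
}.

(* [Din] is for edges directed into the rewritten vertex, [Dout] for edges
   directed out of it. *)
Notation direction := bool (only parsing).
Notation Din := true (only parsing).
Notation Dout := false (only parsing).

Section Graphs.

Variable A : alphabet.
Local Notation Sg := (Sigma A).
Local Notation Gm := (Gamma A).

Record graph := Graph {
  vert :> finType;
  edges : {set vert * Gm * vert};
  lab : vert -> Sg;
  edges_irrefl : forall v g w, (v, g, w) \in edges -> v != w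
}.

Record hom (G H : graph) := Hom {
  hfun :> G -> H;
  hom_lab : forall v, lab (hfun v) = lab v;
  hom_edge : forall v g w,
    (v, g, w) \in edges G -> (hfun v, g, hfun w) \in edges H
}.

Lemma comp_hom_lab (G H K : graph) (f : hom H K) (g : hom G H) v :
  lab ((f \o g) v) = lab v.
Proof. by rewrite /= !hom_lab. Qed.

Lemma comp_hom_edge (G H K : graph) (f : hom H K) (g : hom G H) v c w :
  (v, c, w) \in edges G -> ((f \o g) v, c, (f \o g) w) \in edges K.
Proof. by move=> e; apply/hom_edge/hom_edge. Qed.

Definition comp_hom (G H K : graph) (f : hom H K) (g : hom G H) : hom G K :=
  Hom (comp_hom_lab f g) (@comp_hom_edge _ _ _ f g).

(* Pushouts are taken in the (adhesive) category of directed labelled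
   multigraphs, into which graphs embed fully by [mgraph_of]. In a category of
   graphs whose edges form a set of triples, pushout complements would not be
   unique: an edge of the match joining two interface vertices could also be
   kept in the complement. *)
Record mgraph := MGraph {
  mvert : finType;
  medge : finType;
  msrc : medge -> mvert;
  mtgt : medge -> mvert;
  mvlab : mvert -> Sg;
  melab : medge -> Gm
}.

Record mhom (G H : mgraph) := MHom {
  mhv : mvert G -> mvert H;
  mhe : medge G -> medge H;
  mhom_src : forall e, msrc (mhe e) = mhv (msrc e);
  mhom_tgt : forall e, mtgt (mhe e) = mhv (mtgt e);
  mhom_vlab : forall v, mvlab (mhv v) = mvlab v;
  mhom_elab : forall e, melab (mhe e) = melab e
}.

Definition mgraph_of (G : graph) : mgraph :=
  @MGraph G {e : G * Gm * G | e \in edges G}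
    (fun e => (val e).1.1) (fun e => (val e).2) (@lab G) (fun e => (val e).1.2).

Definition hom_medge (G H : graph) (f : hom G H)
    (e : medge (mgraph_of G)) : medge (mgraph_of H) :=
  let: exist (v, g, w) e_in := e in
  exist (fun e => e \in edges H) (f v, g, f w) (hom_edge f e_in).

Lemma mhom_of_src G H (f : hom G H) e : msrc (hom_medge f e) = f (msrc e).
Proof. by case: e => [[[v g] w] e_in]. Qed.
Lemma mhom_of_tgt G H (f : hom G H) e : mtgt (hom_medge f e) = f (mtgt e).
Proof. by case: e => [[[v g] w] e_in]. Qed.
Lemma mhom_of_elab G H (f : hom G H) e : melab (hom_medge f e) = melab e.
Proof. by case: e => [[[v g] w] e_in]. Qed.

Definition mhom_of (G H : graph) (f : hom G H) :
    mhom (mgraph_of G) (mgraph_of H) :=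
  @MHom (mgraph_of G) (mgraph_of H) f (hom_medge f)
    (mhom_of_src f) (mhom_of_tgt f) (hom_lab f) (mhom_of_elab f).

Definition mcomp_eq (I P Q X : mgraph)
    (f : mhom P X) (g : mhom I P) (f' : mhom Q X) (g' : mhom I Q) : Prop :=
  mhv f \o mhv g =1 mhv f' \o mhv g' /\ mhe f \o mhe g =1 mhe f' \o mhe g'.

Definition mfactors (P Q X : mgraph) (h : mhom Q X) (f : mhom P Q)
    (g : mhom P X) : Prop :=
  mhv h \o mhv f =1 mhv g /\ mhe h \o mhe f =1 mhe g.

Definition mpushout (I L K H : mgraph) (l : mhom I L) (k : mhom I K)
    (m : mhom L H) (n : mhom K H) : Prop :=
  mcomp_eq m l n k /\
  forall (X : mgraph) (a : mhom L X) (b : mhom K X), mcomp_eq a l b k ->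
    exists2 h : mhom H X, mfactors h m a /\ mfactors h n b &
      forall h' : mhom H X, mfactors h' m a -> mfactors h' n b ->
        mhv h' =1 mhv h /\ mhe h' =1 mhe h.

Definition pushout (I L K H : graph) (l : hom I L) (k : hom I K)
    (m : hom L H) (n : hom K H) : Prop :=
  mpushout (mhom_of l) (mhom_of k) (mhom_of m) (mhom_of n).

Definition is_node (G : graph) (v : G) : bool := lab v \in nodeL A.
Definition is_wire (G : graph) (v : G) : bool := lab v \in wireL A.

Definition in_edges (G : graph) (v : G) := [set e in edges G | e.2 == v].
Definition out_edges (G : graph) (v : G) := [set e in edges G | e.1.1 == v].

Definition is_input (G : graph) (v : G) : bool :=
  is_wire v && (in_edges v == set0).
Definition is_output (G : graph) (v : G) : bool :=
  is_wire v && (out_edges v == set0).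
Definition is_boundary (G : graph) (v : G) : bool :=
  is_input v || is_output v.

Definition wire_degree_le1 (G : graph) : Prop :=
  forall v : G, is_wire v -> #|in_edges v| <= 1 /\ #|out_edges v| <= 1.

Definition adjacent (G : graph) (v w : G) : bool :=
  [exists g, ((v, g, w) \in edges G) || ((w, g, v) \in edges G)].

Definition connected (G : graph) : Prop :=
  forall v w : G, connect (@adjacent G) v w.

(* Encoding symbols only occur in encoded string graphs, hence
   [sg_edge_label]. *)
Record string_graph (G : graph) : Prop := StringGraph {
  sg_label : forall v : G, lab v \in nodeL A :|: wireL A;
  sg_edge_label : forall v g w, (v, g, w) \in edges G -> g \notin encL A;
  sg_no_node_edge : forall v g w,
    (v, g, w) \in edges G -> ~~ (is_node v && is_node w);
  sg_wire_degree : wire_degree_le1 G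
}.

(* [H'] is [H] with the edge from the wire-vertex [w1] to the wire-vertex [w2]
   contracted, [q] being the quotient map. As [H'] has no loops, two
   wire-vertices forming a circle cannot be merged. The conditions on the edges
   at [w1] and [w2] hold automatically in string graphs; in a larger host graph
   they say that, read backwards, splitting [q w1] leaves its incoming edges on
   [w1] and its outgoing edges on [w2]. *)
Record merge (H H' : graph) (w1 w2 : H) (q : H -> H') : Prop := Merge {
  merge_wire : is_wire w1;
  merge_same_label : lab w2 = lab w1;
  merge_edge : exists2 g, g \notin encL A &
    [/\ (w1, g, w2) \in edges H,
        forall g' z, (w1, g', z) \in edges H -> g' = g /\ z = w2
      & forall z g', (z, g', w2) \in edges H -> z = w1 /\ g' = g];
  merge_surj : forall y, exists x, q x = y;
  merge_fibre : forall x y, q x = q y <->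
    [\/ x = y, x = w1 /\ y = w2 | x = w2 /\ y = w1];
  merge_lab : forall x, lab (q x) = lab x;
  merge_edges : edges H' =
    [set (q e.1.1, e.1.2, q e.2) | e in edges H & (e.1.1, e.2) != (w1, w2)]
}.

Definition merge_step (H H' : graph) : Prop :=
  exists w1 w2 q, @merge H H' w1 w2 q.

Definition wire_homeo : graph -> graph -> Prop :=
  clos_refl_sym_trans graph merge_step.

Definition matching (L H Ht : graph) (m : hom L Ht) : Prop :=
  [/\ wire_homeo H Ht, injective m
    & forall v g w, (v, g, w) \in edges Ht ->
        (v \in codom m) != (w \in codom m) ->
        exists2 b : L, is_boundary b & m b = v \/ m b = w].

Record span := Span {
  sp_lhs : graph;
  sp_ifc : graph;
  sp_rhs : graph;
  sp_l : hom sp_ifc sp_lhs;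
  sp_r : hom sp_ifc sp_rhs;
  sp_l_inj : injective sp_l;
  sp_r_inj : injective sp_r
}.

(* The interface is the discrete graph on the boundary; a common boundary
   vertex has the same input/output status on both sides. *)
Record string_graph_rule (r : span) : Prop := StringGraphRule {
  sgr_lhs : string_graph (sp_lhs r);
  sgr_rhs : string_graph (sp_rhs r);
  sgr_discrete : edges (sp_ifc r) = set0;
  sgr_l : forall v, (v \in codom (sp_l r)) = is_boundary v;
  sgr_r : forall v, (v \in codom (sp_r r)) = is_boundary v;
  sgr_input : forall i, is_input (sp_l r i) = is_input (sp_r r i);
  sgr_output : forall i, is_output (sp_l r i) = is_output (sp_r r i)
}.

Record decoding_rule (a : Gm) (n1 n2 : Sg) (r : span) : Prop := DecodingRule {
  dr_lhs : exists v1 v2 : sp_lhs r,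
    [/\ v1 != v2, (forall v, v = v1 \/ v = v2),
        edges (sp_lhs r) = [set (v1, a, v2)], lab v1 = n1 & lab v2 = n2];
  dr_discrete : edges (sp_ifc r) = set0;
  dr_ifc : forall v, v \in codom (sp_l r);
  dr_rhs : string_graph (sp_rhs r);
  dr_connected : connected (sp_rhs r);
  dr_closed : forall v : sp_rhs r, ~~ is_boundary v
}.

Definition decoding_system : Type :=
  {a : Gm | a \in encL A} ->
  {n : Sg | n \in nodeL A} -> {n : Sg | n \in nodeL A} -> span.

Definition decoding_system_ok (T : decoding_system) : Prop :=
  forall a n1 n2, decoding_rule (val a) (val n1) (val n2) (T a n1 n2).

(* [(s, b, c, x, d)] stands for the instruction (s, b/c, x, d). *)
Definition instruction (V : finType) : finType :=
  (Sg * Gm * Gm * V * direction)%type.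

Record egraph := EGraph {
  body :> graph;
  instr : {set instruction body}
}.

Definition map_instr (V V' : finType) (f : V -> V') (C : {set instruction V}) :
    {set instruction V'} :=
  [set (let: (s, b, c, x, d) := i in (s, b, c, f x, d)) | i in C].

Definition has_instr (D : egraph) (x : D) : Prop :=
  exists s b c d, (s, b, c, x, d) \in instr D.

Record production := Production {
  plhs : Sg;
  prhs : egraph
}.

(* The productions form a finite family rather than a set, so that a production
   is not lost when it becomes equal to another one. *)
Record edNCE := EdNCE {
  terminals : {set Sg};
  finals : {set Gm};
  pidx : finType;
  prod_of : pidx -> production;
  start : Sg;
  plhs_nonterminal : forall p, plhs (prod_of p) \notin terminals;
  start_nonterminal : start \notin terminals
}.

Record BedNCE (G : edNCE) : Prop := BEdNCE {
  B_body : forall (p : pidx G) v g w,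
    (v, g, w) \in edges (prhs (prod_of p)) ->
    (lab v \in terminals G) || (lab w \in terminals G);
  B_instr : forall (p : pidx G) s b c x d,
    (s, b, c, x, d) \in instr (prhs (prod_of p)) -> s \in terminals G
}.

(* The edge of [D] labelled [g] between [y] and [w] whose direction, seen from
   [y], is [d]. *)
Definition dir_edge (D : graph) (d : direction) (w : D) (g : Gm) (y : D) :=
  if d is Din then (w, g, y) else (y, g, w).

Record BESG := MkBESG {
  bgram : edNCE;
  bdec : decoding_system
}.

Definition cond_N1 (D : egraph) : Prop :=
  forall v g w, (v, g, w) \in edges D -> (g \in encL A) = is_node v && is_node w.

Definition cond_N2 (D : egraph) : Prop :=
  forall s a b (x : D) d, (s, a, b, x, d) \in instr D ->
    s \in nodeL A -> is_node x -> b \in encL A.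

Definition cond_W1 (D : egraph) : Prop := wire_degree_le1 D.

Definition cond_W2 (D : egraph) : Prop :=
  forall s a b (x : D) d, (s, a, b, x, d) \in instr D -> ~~ is_wire x.

Definition cond_W3 (D : egraph) : Prop :=
  forall s c d, s \in wireL A ->
    (forall b x b' x', (s, c, b, x, d) \in instr D ->
       (s, c, b', x', d) \in instr D -> b = b' /\ x = x') /\
    (forall b x, (s, c, b, x, d) \in instr D -> b \notin encL A).

Definition cond_W4 (G : edNCE) (D : egraph) : Prop :=
  forall (y : D) s b d, lab y \notin terminals G -> s \in wireL A ->
    (exists2 w : D, lab w = s & dir_edge d w b y \in edges D) \/
    (exists a, (s, a, b, y, d) \in instr D) ->
  forall q : pidx G, plhs (prod_of q) = lab y ->
    exists c z, (s, b, c, z, d) \in instr (prhs (prod_of q)).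

Record BESG_grammar (B : BESG) : Prop := BESGGrammar {
  besg_dec : decoding_system_ok (bdec B);
  besg_B : BedNCE (bgram B);
  besg_terminals : terminals (bgram B) = nodeL A :|: wireL A;
  besg_finals : finals (bgram B) = [set: Gm];
  besg_N1 : forall p, cond_N1 (prhs (@prod_of (bgram B) p));
  besg_N2 : forall p, cond_N2 (prhs (@prod_of (bgram B) p));
  besg_W1 : forall p, cond_W1 (prhs (@prod_of (bgram B) p));
  besg_W2 : forall p, cond_W2 (prhs (@prod_of (bgram B) p));
  besg_W3 : forall p, cond_W3 (prhs (@prod_of (bgram B) p));
  besg_W4 : forall p, cond_W4 (bgram B) (prhs (@prod_of (bgram B) p))
}.

Definition cond_NT (Delta : {set Sg}) (D1 D2 : graph) : Prop :=
  exists2 f : {x : D1 | lab x \notin Delta} -> {x : D2 | lab x \notin Delta},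
    bijective f & forall x, lab (val (f x)) = lab (val x).

Definition cond_IO (D1 D2 : graph) : Prop :=
  (exists f : {x : D1 | is_input x} -> {x : D2 | is_input x}, bijective f) /\
  (exists f : {x : D1 | is_output x} -> {x : D2 | is_output x}, bijective f).

Record rewrite_pattern (B1 B2 : BESG)
    (corr : pidx (bgram B1) -> pidx (bgram B2)) : Prop := RewritePattern {
  rp_B1 : BESG_grammar B1;
  rp_B2 : BESG_grammar B2;
  rp_dec : bdec B1 = bdec B2;
  rp_terminals : terminals (bgram B1) = terminals (bgram B2);
  rp_start : start (bgram B1) = start (bgram B2);
  rp_corr : bijective corr;
  rp_lhs : forall p, plhs (prod_of (corr p)) = plhs (prod_of p);
  rp_NT : forall p, cond_NT (terminals (bgram B1))
    (prhs (prod_of p)) (prhs (prod_of (corr p)));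
  rp_IO : forall p, cond_IO (prhs (prod_of p)) (prhs (prod_of (corr p)))
}.

Record located := Located {
  loc_sub : graph;
  loc_host : egraph;
  loc_inc : hom loc_sub loc_host;
  loc_inj : injective loc_inc
}.

Record final_subgraph (Delta : {set Sg}) (U : located) : Prop :=
  FinalSubgraph {
  fs_string : string_graph (loc_sub U);
  fs_nonadjacent : forall (x : loc_sub U) (y : loc_host U),
    lab y \notin Delta -> ~~ adjacent (loc_inc U x) y;
  fs_no_instr : forall x : loc_sub U, ~ has_instr (loc_inc U x)
}.

(* A merging of two wire-vertices of the subgraph, carried out in the subgraph
   and in its host simultaneously. *)
Definition located_merge_step (U U' : located) : Prop :=
  exists w1 w2 (q : loc_sub U -> loc_sub U') (qh : loc_host U -> loc_host U'),
    [/\ merge w1 w2 q,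
        merge (loc_inc U w1) (loc_inc U w2) qh,
        forall x, loc_inc U' (q x) = qh (loc_inc U x)
      & instr (loc_host U') = map_instr qh (instr (loc_host U))].

Definition located_homeo : located -> located -> Prop :=
  clos_refl_sym_trans located located_merge_step.

Lemma located_homeo_sub U U' :
  located_homeo U U' -> wire_homeo (loc_sub U) (loc_sub U').
Proof.
elim=> {U U'} [U U' [w1 [w2 [q [qh [mg _ _ _]]]]]|U|U U' _|U V W _ UV _ VW].
- by apply: rst_step; exists w1, w2, q.
- exact: rst_refl.
- exact: rst_sym.
- exact: rst_trans UV VW.
Qed.

(* The instructions live on the part [K] of [D] untouched by the rewriting, and
   are carried from [D] to [D'] through it. *)
Definition dpo (r : span) (D D' : egraph) (m : hom (sp_lhs r) D) : Prop :=
  exists (K : egraph) (k : hom (sp_ifc r) K) (n : hom K D)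
    (m' : hom (sp_rhs r) D') (n' : hom K D'),
    [/\ pushout (sp_l r) k m n, pushout (sp_r r) k m' n',
        instr D = map_instr n (instr K) & instr D' = map_instr n' (instr K)].

(* The left-hand side is matched into a graph wire-homeomorphic to the final
   subgraph [S] of [D]; the rule is applied to the correspondingly modified
   [D]. *)
Definition rewrites_final (Delta : {set Sg}) (r : span) (D D' : egraph) : Prop :=
  exists (S : graph) (i : hom S D) (i_inj : injective i)
    (Ut : located) (m : hom (sp_lhs r) (loc_sub Ut)),
    let U := Located i_inj in
    [/\ final_subgraph Delta U, located_homeo U Ut, matching S m
      & dpo D' (comp_hom (loc_inc Ut) m)].

Record transformation_step (r : span) (B B' : BESG)
    (p : pidx (bgram B)) (corr : pidx (bgram B) -> pidx (bgram B')) : Prop :=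
  TransformationStep {
  ts_dec : bdec B' = bdec B;
  ts_terminals : terminals (bgram B') = terminals (bgram B);
  ts_finals : finals (bgram B') = finals (bgram B);
  ts_start : start (bgram B') = start (bgram B);
  ts_corr : bijective corr;
  ts_same : forall q, q != p -> prod_of (corr q) = prod_of q;
  ts_lhs : plhs (prod_of (corr p)) = plhs (prod_of p);
  ts_rhs : rewrites_final (terminals (bgram B)) r
    (prhs (prod_of p)) (prhs (prod_of (corr p)))
}.

End Graphs.

(* Main.v *)
Require Import Defs.
From mathcomp Require Import all_boot.

(** Merging or splitting wire-vertices and gluing in the right-hand side of a
    rule are treated alike. Each relates the vertices of two bodies by a
    label-preserving relation that covers all non-terminals and all vertices
    with instructions; an edge not related to an edge of the other body lies in
    a string graph. This transfers every condition except the degree bound (W1)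
    and the bijections (IO), which depend only on the edges arriving at (or
    leaving) a wire-vertex. A merging leaves these unchanged. In the double
    pushout, an interface vertex is an input of [L] iff it is an input of [R],
    so, the degrees being at most one, exchanging [L] for [R] changes neither
    the in-degree nor the out-degree of any remaining wire-vertex, and no
    vertex outside the interface is an input or output. *)

Set Implicit Arguments.
Unset Strict Implicit.
Unset Printing Implicit Defensive.

(** * Bijections extracted from relations *)

(** Choosing a partner in each direction gives mutually inverse maps, since partners are unique.
    Uniqueness is asked only within [P1] and [P2]: splitting relates one wire-vertex to two, of
    which only one can be an end in a given direction. *)
Lemma bijective_of_rel (T1 T2 : finType) (P1 : pred T1) (P2 : pred T2)
    (e : T1 -> T2 -> bool) :
  (forall x, P1 x -> exists2 y, P2 y & e x y) ->
  (forall y, P2 y -> exists2 x, P1 x & e x y) ->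
  (forall x y y', e x y -> e x y' -> P2 y -> P2 y' -> y = y') ->
  (forall x x' y, e x y -> e x' y -> P1 x -> P1 x' -> x = x') ->
  exists2 f : {x | P1 x} -> {y | P2 y},
    bijective f & forall x, e (val x) (val (f x)).
Proof.
move=> tot1 tot2 fun1 fun2.
have ex1 (x : {x | P1 x}) : exists y : {y | P2 y}, e (val x) (val y).
  by case: x => x Px; have [y Py exy] := tot1 _ Px; exists (exist _ y Py).
have ex2 (y : {y | P2 y}) : exists x : {x | P1 x}, e (val x) (val y).
  by case: y => y Py; have [x Px exy] := tot2 _ Py; exists (exist _ x Px).
exists (fun x => xchoose (ex1 x)); last by move=> x; apply: (xchooseP (ex1 x)).
exists (fun y => xchoose (ex2 y)) => [x|y]; apply: val_inj.
- have e1 := xchooseP (ex1 x); have e2 := xchooseP (ex2 (xchoose (ex1 x))).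
  exact: fun2 e2 e1 (valP _) (valP _).
- have e1 := xchooseP (ex2 y); have e2 := xchooseP (ex1 (xchoose (ex2 y))).
  exact: fun1 e2 e1 (valP _) (valP _).
Qed.

Section Transformation.

Variable A : alphabet.
Local Notation terminalL := (nodeL A :|: wireL A).

(** * Labels, directed edges and ends of wires *)

Lemma is_wireNnode (G : graph A) (v : G) : is_wire v -> ~~ is_node v.
Proof.
by move=> wv; apply/negP => nv; have /pred0P/(_ (lab v)) :=
  nodeL_wireL_disjoint A; rewrite /= [lab v \in nodeL A]nv [lab v \in _]wv.
Qed.

Lemma terminal_wire (G : graph A) (v : G) : is_wire v -> lab v \in terminalL.
Proof. by rewrite /is_wire inE orbC => ->. Qed.

Lemma hom_wire (G H : graph A) (f : hom G H) v : is_wire (f v) = is_wire v.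
Proof. by rewrite /is_wire hom_lab. Qed.

Lemma hom_node (G H : graph A) (f : hom G H) v : is_node (f v) = is_node v.
Proof. by rewrite /is_node hom_lab. Qed.

Lemma hom_dir_edge (G H : graph A) (f : hom G H) d u g v :
  dir_edge d u g v \in edges G -> dir_edge d (f u) g (f v) \in edges H.
Proof. by case: d => /hom_edge; apply. Qed.

Definition uniq_dir_edge (G : graph A) d (v : G) : Prop :=
  forall u g u' g', dir_edge d u g v \in edges G ->
    dir_edge d u' g' v \in edges G -> u = u' /\ g = g'.

(** Inputs for [Din] and outputs for [Dout], under one definition so that both directions share
    every argument below. *)
Definition wire_end (G : graph A) d (v : G) : bool :=
  is_wire v && [forall u, forall g, dir_edge d u g v \notin edges G].

Lemma wire_endP (G : graph A) d (v : G) :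
  reflect (is_wire v /\ forall u g, dir_edge d u g v \notin edges G)
    (wire_end d v).
Proof.
apply: (iffP andP) => [[-> /forallP ev]|[-> ev]]; split=> //.
- by move=> u g; apply: (forallP (ev u)).
- by apply/forallP => u; apply/forallP => g.
Qed.

Lemma wire_endPn (G : graph A) d (v : G) : is_wire v ->
  reflect (exists u g, dir_edge d u g v \in edges G) (~~ wire_end d v).
Proof.
rewrite /wire_end => ->; apply: (iffP forallPn).
- by case=> u /forallPn [g]; rewrite negbK; exists u, g.
- by case=> u [g e]; exists u; apply/forallPn; exists g; rewrite negbK.
Qed.

Lemma wire_end_input (G : graph A) (v : G) : wire_end Din v = is_input v.
Proof.
rewrite /wire_end /is_input; congr (_ && _); apply/forallP/eqP => [ev|e0 u].
- apply/setP => [[[u g] w]]; rewrite !inE /=; case: eqP => [->|_].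
    by rewrite andbT (negbTE (forallP (ev u) g)).
  by rewrite andbF.
- apply/forallP => g; have /setP/(_ (u, g, v)) := e0.
  by rewrite !inE eqxx andbT => ->.
Qed.

Lemma wire_end_output (G : graph A) (v : G) : wire_end Dout v = is_output v.
Proof.
rewrite /wire_end /is_output; congr (_ && _); apply/forallP/eqP => [ev|e0 u].
- apply/setP => [[[u g] w]]; rewrite !inE /=; case: eqP => [->|_].
    by rewrite andbT (negbTE (forallP (ev w) g)).
  by rewrite andbF.
- apply/forallP => g; have /setP/(_ (v, g, u)) := e0.
  by rewrite !inE eqxx andbT => ->.
Qed.

Lemma wire_end_boundary (G : graph A) d (v : G) :
  wire_end d v -> is_boundary v.
Proof.
by case: d; rewrite ?wire_end_input ?wire_end_output /is_boundary => ->;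
  rewrite ?orbT.
Qed.

Lemma wire_degree_le1P (G : graph A) :
  wire_degree_le1 G <-> forall d (v : G), is_wire v -> uniq_dir_edge d v.
Proof.
split=> [deg d v /deg [din dout] u g u' g'|un v wv].
- case: d => e e'.
  + by have /card_le1P/(_ (u, g, v)) := din;
      rewrite inE e /= eqxx => /(_ isT) /(_ (u', g', v));
      rewrite !inE e' /= eqxx => /esym/eqP [-> ->].
  + by have /card_le1P/(_ (v, g, u)) := dout;
      rewrite inE e /= eqxx => /(_ isT) /(_ (v, g', u'));
      rewrite !inE e' /= eqxx => /esym/eqP [-> ->].
- split; apply/card_le1_eqP => [[[u g] w] [[u' g'] w']]; rewrite !inE /=.
  + by move=> /andP[e /eqP ?] /andP[e' /eqP ?]; subst w w';
      have [-> ->] := un Din v wv _ _ _ _ e e'.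
  + by move=> /andP[e /eqP ?] /andP[e' /eqP ?]; subst u u';
      have [-> ->] := un Dout v wv _ _ _ _ e e'.
Qed.

Lemma map_instrP (V V' : finType) (f : V -> V') (C : {set instruction A V})
    s b c y d :
  reflect (exists2 x, f x = y & (s, b, c, x, d) \in C)
    ((s, b, c, y, d) \in map_instr f C).
Proof.
apply: (iffP imsetP) => [[[[[[s' b'] c'] x] d'] iC [-> -> -> -> ->]]|[x <- iC]].
- by exists x.
- by exists (s, b, c, x, d).
Qed.

(** * Transfer of the grammar conditions along a relation *)

(** The share of [BESG_grammar] borne by a single body. It keeps [G] as a parameter, so a body of
    [B'] can first be checked against the grammar of [B]; only W4 looks at the other productions. *)
Record body_ok (G : edNCE A) (D : egraph A) : Prop := BodyOk {
  ok_body : forall v g w, (v, g, w) \in edges D ->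
    (lab v \in terminals G) || (lab w \in terminals G);
  ok_instr : forall s b c x d,
    (s, b, c, x, d) \in instr D -> s \in terminals G;
  ok_N1 : cond_N1 D;
  ok_N2 : cond_N2 D;
  ok_W1 : cond_W1 D;
  ok_W2 : cond_W2 D;
  ok_W3 : cond_W3 D;
  ok_W4 : cond_W4 G D
}.

(** One-way: what [D2] must satisfy is traced back to [D1]. [tr_fun] spares wire-vertices because of
    splitting. The second case of [tr_edge] is for new edges: the contracted edge of a merging, or
    an edge of the glued-in side of a rule. *)
Record transfers (D1 D2 : egraph A) (e : D1 -> D2 -> bool) : Prop := Transfers {
  tr_lab : forall x y, e x y -> lab x = lab y;
  tr_fun : forall x y y', e x y -> e x y' -> ~~ is_wire x -> y = y';
  tr_total : forall x, lab x \notin terminalL -> exists y, e x y;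
  tr_edge : forall v' g w', (v', g, w') \in edges D2 ->
    (exists v w, [/\ e v v', e w w' & (v, g, w) \in edges D1]) \/
    [/\ lab v' \in terminalL, lab w' \in terminalL, g \notin encL A
      & ~~ (is_node v' && is_node w')];
  tr_instr : forall s b c y d, (s, b, c, y, d) \in instr D2 ->
    exists2 x, e x y & (s, b, c, x, d) \in instr D1;
  tr_degree : wire_degree_le1 D1 -> wire_degree_le1 D2;
  tr_end : forall d x, wire_end d x -> exists2 y, wire_end d y & e x y;
  tr_end_fun : forall d x y y', e x y -> e x y' ->
    wire_end d y -> wire_end d y' -> y = y'
}.

Lemma transfers_body_ok (G : edNCE A) (D1 D2 : egraph A)
    (e : D1 -> D2 -> bool) :
  terminals G = terminalL -> transfers e -> body_ok G D1 -> body_ok G D2.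
Proof.
move=> tG tr ok; split.
- move=> v g w /(tr_edge tr) [[v0 [w0 [ev ew /(ok_body ok)]]]|[]].
    by rewrite (tr_lab tr ev) (tr_lab tr ew).
  by rewrite tG => ->.
- by move=> s b c x d /(tr_instr tr) [x0 _ /(ok_instr ok)].
- move=> v g w /(tr_edge tr) [[v0 [w0 [ev ew /(ok_N1 ok) ->]]]|[_ _]].
    by rewrite /is_node (tr_lab tr ev) (tr_lab tr ew).
  by move=> /negbTE -> /negbTE ->.
- move=> s a b x d /(tr_instr tr) [x0 ex i0] sN.
  by rewrite /is_node -(tr_lab tr ex); apply: (ok_N2 ok i0 sN).
- exact: tr_degree tr (ok_W1 ok).
- move=> s a b x d /(tr_instr tr) [x0 ex /(ok_W2 ok)].
  by rewrite /is_wire (tr_lab tr ex).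
- move=> s c d sW; have [un nenc] := ok_W3 ok c d sW; split.
    move=> b x b' x' /(tr_instr tr) [x0 ex i0] /(tr_instr tr) [x0' ex' i0'].
    have [<- eqx] := un _ _ _ _ i0 i0'; split=> //; subst x0'.
    (* By W2 a vertex with instructions is not a wire-vertex, so its partner is unique. *)
    exact: (tr_fun tr ex ex' (ok_W2 ok i0)).
  by move=> b x /(tr_instr tr) [x0 _ /nenc].
- move=> y s b d ntY sW adj q lhsq.
  suff [y0 ey adj0]: exists2 y0, e y0 y &
      (exists2 w, lab w = s & dir_edge d w b y0 \in edges D1) \/
      (exists a, (s, a, b, y0, d) \in instr D1).
    by apply: (ok_W4 ok _ sW adj0); rewrite (tr_lab tr ey).
  case: adj => [[w lw ew]|[a /(tr_instr tr) [y0 ey i0]]]; last first.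
    by exists y0 => //; right; exists a.
  (* A new edge has terminal ends, so it cannot touch the non-terminal [y]; the edge at [y]
     therefore comes from [D1]. *)
  case: d ew => /(tr_edge tr) [[v0 [w0 [ev0 ew0 e0]]]|[t1 t2 _ _]].
  + by exists w0 => //; left; exists v0 => //; rewrite (tr_lab tr ev0).
  + by move: ntY; rewrite tG t2.
  + by exists v0 => //; left; exists w0 => //; rewrite (tr_lab tr ew0).
  + by move: ntY; rewrite tG t1.
Qed.

(** * Similarity of production bodies *)

(** An equivalence relation, hence stable under chains of mergings and splittings. The last clause
    serves W4, which asks other productions for instructions with given [s], [b] and [d]. *)
Definition similar (G : edNCE A) (D1 D2 : egraph A) : Prop :=
  [/\ body_ok G D1 <-> body_ok G D2,
      cond_NT (terminals G) D1 D2,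
      cond_IO D1 D2
    & forall s b d, (exists c z, (s, b, c, z, d) \in instr D1) <->
                    (exists c z, (s, b, c, z, d) \in instr D2)].

Lemma cond_NT_refl Delta (D : graph A) : cond_NT Delta D D.
Proof. by exists id => //; exists id. Qed.

Lemma cond_NT_sym Delta (D1 D2 : graph A) :
  cond_NT Delta D1 D2 -> cond_NT Delta D2 D1.
Proof.
case=> f [f' fK f'K] lf; exists f'; first by exists f.
by move=> x; rewrite -lf f'K.
Qed.

Lemma cond_NT_trans Delta (D1 D2 D3 : graph A) :
  cond_NT Delta D1 D2 -> cond_NT Delta D2 D3 -> cond_NT Delta D1 D3.
Proof.
case=> f fb lf [h hb lh]; exists (h \o f); first exact: bij_comp.
by move=> x /=; rewrite lh lf.
Qed.

Lemma cond_IO_refl (D : graph A) : cond_IO D D.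
Proof. by split; exists id; exists id. Qed.

Lemma cond_IO_sym (D1 D2 : graph A) : cond_IO D1 D2 -> cond_IO D2 D1.
Proof.
by case=> [[f [f' fK f'K]] [h [h' hK h'K]]]; split;
  [exists f'; exists f|exists h'; exists h].
Qed.

Lemma cond_IO_trans (D1 D2 D3 : graph A) :
  cond_IO D1 D2 -> cond_IO D2 D3 -> cond_IO D1 D3.
Proof.
case=> [[f fb] [h hb]] [[f' fb'] [h' hb']].
by split; [exists (f' \o f)|exists (h' \o h)]; apply: bij_comp.
Qed.

Lemma similar_refl G D : similar G D D.
Proof. by split=> //; [apply: cond_NT_refl|apply: cond_IO_refl]. Qed.

Lemma similar_sym G D1 D2 : similar G D1 D2 -> similar G D2 D1.
Proof.
case=> ok nt io sg; split; [by case: ok|exact: cond_NT_sym| |].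
- exact: cond_IO_sym.
- by move=> s b d; case: (sg s b d).
Qed.

Lemma similar_trans G D1 D2 D3 :
  similar G D1 D2 -> similar G D2 D3 -> similar G D1 D3.
Proof.
case=> [[ok ok'] nt io sg] [[ok2 ok2'] nt2 io2 sg2]; split.
- by split=> [/ok/ok2|/ok2'/ok'].
- exact: cond_NT_trans nt nt2.
- exact: cond_IO_trans io io2.
- move=> s b d; case: (sg s b d) (sg2 s b d) => [h h'] [h2 h2'].
  by split=> [/h/h2|/h2'/h'].
Qed.

Lemma transfers_similar (G : edNCE A) (D1 D2 : egraph A)
    (e : D1 -> D2 -> bool) :
  terminals G = terminalL -> transfers e -> transfers (fun y x => e x y) ->
  similar G D1 D2.
Proof.
move=> tG tr tr'.
have ntW (D : egraph A) (x : D) : lab x \notin terminals G -> ~~ is_wire x.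
  by rewrite tG; apply/contra/terminal_wire.
have ends d (P1 : pred D1) (P2 : pred D2) :
    @wire_end D1 d =1 P1 -> @wire_end D2 d =1 P2 ->
    exists f : {x | P1 x} -> {y | P2 y}, bijective f.
  move=> P1E P2E; have [||||f fb _] := @bijective_of_rel _ _ P1 P2 e.
  + by move=> x; rewrite -P1E => /(tr_end tr) [y]; rewrite P2E; exists y.
  + by move=> y; rewrite -P2E => /(tr_end tr') [x]; rewrite P1E; exists x.
  + by move=> x y y' ey ey'; rewrite -!P2E; apply: (tr_end_fun tr ey ey').
  + by move=> x x' y ex ex'; rewrite -!P1E; apply: (tr_end_fun tr' ex ex').
  + by exists f.
split.
- split; first exact: transfers_body_ok tr.
  exact: transfers_body_ok tr'.
- have [||||f fb ef] := @bijective_of_rel D1 D2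
    (fun x => lab x \notin terminals G) (fun x => lab x \notin terminals G) e.
  + move=> x nx; have [|y ey] := tr_total tr (x := x); first by rewrite -tG.
    by exists y => //; rewrite -(tr_lab tr ey).
  + move=> y ny; have [|x ex] := tr_total tr' (x := y); first by rewrite -tG.
    by exists x => //; rewrite (tr_lab tr ex).
  + move=> x y y' ey ey' ny _; apply: (tr_fun tr ey ey').
    by apply: ntW; rewrite (tr_lab tr ey).
  + move=> x x' y ex ex' nx _; apply: (tr_fun tr' ex ex').
    by apply: ntW; rewrite -(tr_lab tr ex).
  + by exists f => // x; rewrite (tr_lab tr (ef x)).
- split.
  + by apply: (ends Din) => x; rewrite wire_end_input.
  + by apply: (ends Dout) => x; rewrite wire_end_output.
- move=> s b d; split=> [[c [z /(tr_instr tr') [x _ i]]]|];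
    first by exists c, x.
  by case=> c [z /(tr_instr tr) [x _ i]]; exists c, x.
Qed.

(** * Merging of wire-vertices *)

Section Merge.

Variables (H H' : egraph A) (w1 w2 : H) (q : H -> H').
Hypothesis mg : Defs.merge w1 w2 q.
Hypothesis instrH' : instr H' = map_instr q (instr H).

(* The end of the contracted edge keeping its edges of direction [d], and the
   end whose only edge of direction [d] is the contracted one. *)
Let keep (d : bool) := if d then w1 else w2.
Let drop (d : bool) := if d then w2 else w1.

Lemma merge_wire2 : is_wire w2.
Proof. by rewrite /is_wire (merge_same_label mg); apply: merge_wire mg. Qed.

Lemma merge_w12 : q w1 = q w2.
Proof. by apply/(merge_fibre mg); apply: Or32. Qed.

Lemma merge_keep d : keep d != drop d.
Proof.
have [g _ [/edges_irrefl ne _ _]] := merge_edge mg.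
by case: d => //=; rewrite /keep /drop eq_sym.
Qed.

Lemma merge_fibreN d x y : x != drop d -> y != drop d -> q x = q y -> x = y.
Proof.
by case: d => nx ny /(merge_fibre mg) [//|[? ?]|[? ?]]; subst x y;
  rewrite eqxx in nx ny.
Qed.

Lemma merge_lift d (y : H') : exists2 x, x != drop d & q x = y.
Proof.
have [x <-] := merge_surj mg y; have [->|nx] := eqVneq x (drop d).
- exists (keep d); first exact: merge_keep.
  by case: d; rewrite /keep /drop merge_w12.
- by exists x.
Qed.

Lemma merge_edgesP v' g w' :
  reflect (exists v w, [/\ (v, g, w) \in edges H, (v, w) != (w1, w2),
                           q v = v' & q w = w'])
    ((v', g, w') \in edges H').
Proof.
rewrite (merge_edges mg).
apply: (iffP imsetP) => [[[[v g'] w]]|[v [w [e ne <- <-]]]].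
- by rewrite inE /= => /andP[e ne] [-> -> ->]; exists v, w.
- by exists (v, g, w) => //; rewrite inE e.
Qed.

(** Seen in direction [d], the contracted edge is attached to [drop d], so every edge of that
    direction at another vertex survives. *)
Lemma merge_dir_edge d u g v : dir_edge d u g v \in edges H -> v != drop d ->
  dir_edge d (q u) g (q v) \in edges H'.
Proof.
by case: d => e nv; apply/merge_edgesP;
  [exists u, v|exists v, u]; split=> //; rewrite xpair_eqE negb_and nv ?orbT.
Qed.

(** A surviving edge is not attached to [drop d] in direction [d], where only the contracted edge
    is. Its end over [q v] is therefore [v] itself. *)
Lemma merge_dir_edge_lift d u' g v : v != drop d ->
  dir_edge d u' g (q v) \in edges H' ->
  exists2 u, q u = u' & dir_edge d u g v \in edges H.
Proof.
have [g0 _ [_ out1 in2]] := merge_edge mg.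
case: d => nv /merge_edgesP [x [y [e ne qx qy]]].
- exists x => //; suff <- : y = v by [].
  apply: (@merge_fibreN Din) => //; apply: contra ne => /eqP ?; subst y.
  by have [-> _] := in2 _ _ e.
- exists y => //; suff <- : x = v by [].
  apply: (@merge_fibreN Dout) => //; apply: contra ne => /eqP ?; subst x.
  by have [_ ->] := out1 _ _ e.
Qed.

Lemma merge_dir_edge_drop d : uniq_dir_edge d (drop d).
Proof.
have [g0 _ [_ out1 in2]] := merge_edge mg.
case: d => u g u' g'.
- by move=> /in2 [-> ->] /in2 [-> ->].
- by move=> /out1 [-> ->] /out1 [-> ->].
Qed.

Lemma merge_endN d : ~~ wire_end d (drop d).
Proof.
have [g _ [e _ _]] := merge_edge mg.
apply/wire_endPn; last by exists (keep d), g; case: d.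
by case: d; [exact: merge_wire2|exact: merge_wire mg].
Qed.

Lemma merge_end_neq d v : wire_end d v -> v != drop d.
Proof. by apply: contraL => /eqP ->; apply: merge_endN. Qed.

Lemma merge_end d v : v != drop d -> wire_end d (q v) = wire_end d v.
Proof.
move=> nv; apply/wire_endP/wire_endP; rewrite /is_wire (merge_lab mg).
- move=> [wv ev]; split=> // u g; apply: contra (ev (q u) g) => e.
  exact: merge_dir_edge.
- move=> [wv ev]; split=> // u' g; apply/negP.
  by case/(merge_dir_edge_lift nv) => u _; apply/negP.
Qed.

Lemma merge_transfers : transfers (fun x y => q x == y).
Proof.
split.
- by move=> x y /eqP <-; rewrite (merge_lab mg).
- by move=> x y y' /eqP <- /eqP <-.
- by move=> x _; exists (q x).
- move=> v' g w' /merge_edgesP [v [w [e _ qv qw]]].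
  by left; exists v, w; rewrite qv qw !eqxx.
- move=> s b c y d; rewrite instrH' => /map_instrP [x qx i].
  by exists x; rewrite ?qx.
- move=> /wire_degree_le1P deg; apply/wire_degree_le1P => d v' wv'.
  move=> u g u' g'; have [v nv qv] := merge_lift d v'; subst v'.
  move=> /(merge_dir_edge_lift nv) [x <- e].
  move=> /(merge_dir_edge_lift nv) [x' <- e'].
  have wv : is_wire v by move: wv'; rewrite /is_wire (merge_lab mg).
  by have [-> ->] := deg d v wv _ _ _ _ e e'.
- move=> d x ex; exists (q x) => //.
  by rewrite merge_end ?merge_end_neq.
- by move=> d x y y' /eqP <- /eqP <-.
Qed.

(** The only edge of [H] without a counterpart in [H'] is the contracted one, which joins
    wire-vertices and has no encoding label. *)
Lemma split_transfers : transfers (fun y x => q x == y).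
Proof.
have [g0 ng0 [e12 out1 in2]] := merge_edge mg.
split.
- by move=> y x /eqP <-; rewrite (merge_lab mg).
- move=> y x x' /eqP <- /eqP /esym; rewrite /is_wire (merge_lab mg) => qxx' nw.
  case/(merge_fibre mg): qxx' => [//|[? ?]|[? ?]]; subst x x'.
  + by rewrite (merge_wire mg : lab w1 \in _) in nw.
  + by rewrite (merge_wire2 : lab w2 \in _) in nw.
- by move=> y _; have [x qx] := merge_surj mg y; exists x; rewrite qx.
- move=> v g w e; have [[? ?]|ne] := eqVneq (v, w) (w1, w2).
    subst v w; right; have [-> _] := out1 _ _ e.
    rewrite !terminal_wire ?merge_wire2 ?(merge_wire mg) //.
    by split=> //; rewrite negb_and (is_wireNnode merge_wire2) orbT.
  by left; exists (q v), (q w); rewrite !eqxx; split=> //;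
    apply/merge_edgesP; exists v, w.
- move=> s b c x d i; exists (q x) => //; rewrite instrH'.
  by apply/map_instrP; exists x.
- move=> /wire_degree_le1P deg; apply/wire_degree_le1P => d v wv.
  have [->|nv] := eqVneq v (drop d); first exact: merge_dir_edge_drop.
  move=> u g u' g' e e'.
  have wv' : is_wire (q v) by rewrite /is_wire (merge_lab mg).
  have [quu' <-] := deg d _ wv' _ _ _ _ (merge_dir_edge e nv)
    (merge_dir_edge e' nv); split=> //.
  (* If [u] and [u'] differed they would be [w1] and [w2]. One of the two edges would then be the
     contracted one, forcing [v] to be [drop d]. *)
  case/(merge_fibre mg): quu' => [//|[? ?]|[? ?]]; subst u u';
    case: d nv e e' => nv e e'.
  + by move: nv; have [_ ->] := out1 _ _ e; rewrite eqxx.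
  + by move: nv; have [-> _] := in2 _ _ e'; rewrite eqxx.
  + by move: nv; have [_ ->] := out1 _ _ e'; rewrite eqxx.
  + by move: nv; have [-> _] := in2 _ _ e; rewrite eqxx.
- move=> d y; have [x nx <-] := merge_lift d y.
  by rewrite merge_end // => ex; exists x.
- move=> d y x x' /eqP <- /eqP /esym qxx' ex ex'.
  by apply: (@merge_fibreN d); rewrite ?(@merge_end_neq d).
Qed.

End Merge.

Lemma located_homeo_similar (G : edNCE A) (U U' : located A) :
  terminals G = terminalL -> located_homeo U U' ->
  similar G (loc_host U) (loc_host U').
Proof.
move=> tG; elim=> {U U'} [U U' [w1 [w2 [q [qh [_ mg _ ins]]]]]|U|U U' _|].
- apply: transfers_similar tG (merge_transfers mg ins) _.
  exact: split_transfers mg ins.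
- exact: similar_refl.
- exact: similar_sym.
- move=> U V W _ sUV _; exact: similar_trans.
Qed.

(** * Pushouts over a discrete interface *)

Definition mhom_id (X : mgraph A) : mhom X X :=
  @MHom A X X id id (fun _ => erefl) (fun _ => erefl) (fun _ => erefl)
    (fun _ => erefl).

Definition mhom_comp (X Y Z : mgraph A) (f : mhom Y Z) (g : mhom X Y) :
    mhom X Z :=
  @MHom A X Z (mhv f \o mhv g) (mhe f \o mhe g)
    (fun e => etrans (mhom_src f _) (congr1 _ (mhom_src g e)))
    (fun e => etrans (mhom_tgt f _) (congr1 _ (mhom_tgt g e)))
    (fun v => etrans (mhom_vlab f _) (mhom_vlab g v))
    (fun e => etrans (mhom_elab f _) (mhom_elab g e)).

(** The concrete shape of a pushout of injections over a discrete interface. [glue_disjoint]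
    reflects the passage to multigraphs: an edge of [L] and an edge of [K] are never identified in
    [H]. *)
Record gluing (I L K H : graph A) (l : hom I L) (k : hom I K)
    (m : hom L H) (n : hom K H) : Prop := Gluing {
  glue_comm : forall i, m (l i) = n (k i);
  glue_inl : injective m;
  glue_inr : injective n;
  glue_meet : forall x y, m x = n y -> exists2 i, x = l i & y = k i;
  glue_cover : forall v, (exists x, v = m x) \/ (exists y, v = n y);
  glue_edge : forall v g w, (v, g, w) \in edges H ->
    (exists x x', [/\ v = m x, w = m x' & (x, g, x') \in edges L]) \/
    (exists y y', [/\ v = n y, w = n y' & (y, g, y') \in edges K]);
  glue_disjoint : forall x g x' y y', (x, g, x') \in edges L ->
    (y, g, y') \in edges K -> m x = n y -> m x' = n y' -> False
}.

Section Pushout.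

Variables (I L K H : graph A) (l : hom I L) (k : hom I K).
Variables (m : hom L H) (n : hom K H).
Hypothesis discrete : edges I = set0.
Hypotheses (l_inj : injective l) (k_inj : injective k).
Hypothesis po : pushout l k m n.

Let mL := mgraph_of L.
Let mK := mgraph_of K.

(* The gluing of [L] and [K] along [I], except that the copies in [K] of the
   vertices of [I] are kept, isolated, instead of being removed. *)
Definition glue_vert (y : K) : L + K :=
  if [pick i | k i == y] is Some i then inl (l i) else inr y.

Definition glue : mgraph A :=
  @MGraph A (mvert mL + mvert mK)%type (medge mL + medge mK)%type
    (fun e => match e with
              | inl e => inl (msrc e) | inr e => glue_vert (msrc e) end)
    (fun e => match e with
              | inl e => inl (mtgt e) | inr e => glue_vert (mtgt e) end)
    (fun v => match v with inl v => mvlab v | inr v => mvlab v end)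
    (fun e => match e with inl e => melab e | inr e => melab e end).

Lemma glue_vert_ifc i : glue_vert (k i) = inl (l i).
Proof.
rewrite /glue_vert; case: pickP => [j /eqP /k_inj -> //|/(_ i)].
by rewrite eqxx.
Qed.

Lemma glue_vert_inl y x : glue_vert y = inl x -> exists2 i, x = l i & y = k i.
Proof.
by rewrite /glue_vert; case: pickP => // i /eqP <- [<-]; exists i.
Qed.

Lemma glue_vert_inj : injective glue_vert.
Proof.
move=> y y'; rewrite /glue_vert.
case: pickP => [i /eqP <-|_]; case: pickP => [j /eqP <-|_] //.
- by case=> /l_inj ->.
- by case.
Qed.

Definition glue_l : mhom mL glue :=
  @MHom A mL glue inl inl (fun _ => erefl) (fun _ => erefl) (fun _ => erefl)
    (fun _ => erefl).

Lemma glue_vert_lab (y : mvert mK) : @mvlab A glue (glue_vert y) = mvlab y.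
Proof.
by rewrite /glue_vert; case: pickP => //= i /eqP <-; rewrite !hom_lab.
Qed.

Definition glue_r : mhom mK glue :=
  @MHom A mK glue glue_vert inr (fun _ => erefl) (fun _ => erefl)
    glue_vert_lab (fun _ => erefl).

(** With [glue_out_e], this will be a left inverse of the map from [H] to [glue] given by the
    universal property. *)
Definition glue_out_v (v : mvert glue) : mvert (mgraph_of H) :=
  match v with inl x => m x | inr y => n y end.

Definition glue_out_e (e : medge glue) : medge (mgraph_of H) :=
  match e with inl e => hom_medge m e | inr e => hom_medge n e end.

Lemma glue_out_vert (y : K) : glue_out_v (glue_vert y) = n y.
Proof.
rewrite /glue_vert; case: pickP => //= i /eqP <-.
by have [[/(_ i)]] := po.
Qed.

Lemma glue_out_src e : msrc (glue_out_e e) = glue_out_v (msrc e).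
Proof.
by case: e => e /=; rewrite ?glue_out_vert;
  [apply: (mhom_of_src m)|apply: (mhom_of_src n)].
Qed.

Lemma glue_out_tgt e : mtgt (glue_out_e e) = glue_out_v (mtgt e).
Proof.
by case: e => e /=; rewrite ?glue_out_vert;
  [apply: (mhom_of_tgt m)|apply: (mhom_of_tgt n)].
Qed.

Lemma glue_out_vlab v : mvlab (glue_out_v v) = mvlab v.
Proof. by case: v => v /=; apply: hom_lab. Qed.

Lemma glue_out_elab e : melab (glue_out_e e) = melab e.
Proof. by case: e => e; [apply: (mhom_of_elab m)|apply: (mhom_of_elab n)]. Qed.

Definition glue_out : mhom glue (mgraph_of H) :=
  MHom glue_out_src glue_out_tgt glue_out_vlab glue_out_elab.

(** The universal property yields [h] from [H] to [glue] with [h] after [m] equal to [glue_l] and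
    [h] after [n] equal to [glue_r]. Injectivity, overlap and disjointness are read off in [glue];
    covering follows from the left inverse of [h]. *)
Lemma pushout_gluing : gluing l k m n.
Proof.
have [[comm_v comm_e] univ] := po.
have comm : mcomp_eq glue_l (mhom_of l) glue_r (mhom_of k).
  split=> [i|[e e_in]] /=; first by rewrite glue_vert_ifc.
  by exfalso; move: e_in; rewrite discrete inE.
have [h [[hmv hme] [hnv hne]] _] := univ _ _ _ comm.
(* [glue_out \o h] is the identity by uniqueness, hence [glue_out] is onto. *)
have [hH _ uniqH] := univ _ _ _ (conj comm_v comm_e).
have [idv ide] := uniqH (mhom_id _) (conj (fun _ => erefl) (fun _ => erefl))
  (conj (fun _ => erefl) (fun _ => erefl)).
have [|| ghv ghe] := uniqH (mhom_comp glue_out h).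
- split=> x /=; first by have /= -> := hmv x.
  by have /= -> := hme x.
- split=> x /=; first by have /= -> := hnv x; apply: glue_out_vert.
  by have /= -> := hne x.
have onto_v v : glue_out_v (mhv h v) = v by have := ghv v; rewrite -idv.
have onto_e e : glue_out_e (mhe h e) = e by have := ghe e; rewrite -ide.
split.
- exact: comm_v.
- move=> x x' mxx'; have /= := hmv x; rewrite mxx'.
  by have /= -> := hmv x' => -[].
- move=> y y' nyy'; apply: glue_vert_inj.
  by rewrite -[LHS](hnv y) -[RHS](hnv y') /= nyy'.
- move=> x y mxny; apply: glue_vert_inl.
  by rewrite -[LHS](hnv y) /= -mxny; apply: (hmv x).
- move=> v; rewrite -(onto_v v); case: (mhv h v) => z /=.
  + by left; exists z.
  + by right; exists z.
- move=> v g w e; have := onto_e (exist _ (v, g, w) e).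
  case: (mhe h _) => -[[[x g'] x'] e'] [<- <- <-].
  + by left; exists x, x'.
  + by right; exists x, x'.
- move=> x g x' y y' eL eK mxny mx'ny'.
  have := hme (exist _ (x, g, x') eL).
  have := hne (exist _ (y, g, y') eK) => /=.
  (* Were these one edge of [H], [h] would send it to both summands of the edges of [glue]. *)
  set eN := exist _ (n y, g, n y') _; set eM := exist _ (m x, g, m x') _.
  suff -> : eN = eM by move=> ->.
  by apply: val_inj; rewrite /= mxny mx'ny'.
Qed.

End Pushout.

(** * Exchanging the sides of a rule *)

Section Exchange.

Variables (I L R : graph A) (K D1 D2 : egraph A).
Variables (l : hom I L) (r : hom I R) (k : hom I K).
Variables (m1 : hom L D1) (n1 : hom K D1) (m2 : hom R D2) (n2 : hom K D2).
Hypotheses (sL : string_graph L) (sR : string_graph R).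
Hypothesis l_bnd : forall v, (v \in codom l) = is_boundary v.
Hypothesis end_lr : forall d i, wire_end d (l i) = wire_end d (r i).
Hypotheses (glue1 : gluing l k m1 n1) (glue2 : gluing r k m2 n2).
Hypothesis instr1 : instr D1 = map_instr n1 (instr K).
Hypothesis instr2 : instr D2 = map_instr n2 (instr K).

Lemma ifc_wire i : is_wire (l i).
Proof.
have := l_bnd (l i); rewrite codom_f => /esym.
by case/orP => /andP[].
Qed.

Lemma exchange_dir_edge d u g v : dir_edge d u g v \in edges D2 ->
  (exists x x', [/\ u = m2 x, v = m2 x' & dir_edge d x g x' \in edges R]) \/
  (exists y y', [/\ u = n2 y, v = n2 y' & dir_edge d y g y' \in edges K]).
Proof.
by case: d => /(glue_edge glue2) [] [x [x' [-> -> e]]];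
  [left; exists x, x'|right; exists x, x'|
   left; exists x', x|right; exists x', x].
Qed.

Lemma exchange_disjoint d u g v u' v' : dir_edge d u g v \in edges L ->
  dir_edge d u' g v' \in edges K -> m1 u = n1 u' -> m1 v = n1 v' -> False.
Proof.
by case: d => e e' mu mv; apply: (glue_disjoint glue1 e e').
Qed.

(** The edge shows that [r i] is not an end in direction [d]; then neither is [l i], and a
    wire-vertex that is not an end carries an edge. *)
Lemma exchange_ifc_edge d u g i : dir_edge d u g (r i) \in edges R ->
  exists u' g', dir_edge d u' g' (l i) \in edges L.
Proof.
move=> e; apply/(wire_endPn _ (ifc_wire i)); rewrite end_lr.
by apply/wire_endPn; [rewrite hom_wire -(hom_wire l) ifc_wire|exists u, g].
Qed.

(** Two edges of the same direction at a wire-vertex both come from [R], where the degree is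
    bounded, or both from [K], which embeds in [D1], or one from each, which is excluded. *)
Lemma exchange_degree : wire_degree_le1 D1 -> wire_degree_le1 D2.
Proof.
move=> /wire_degree_le1P deg1; have /wire_degree_le1P degR := sg_wire_degree sR.
apply/wire_degree_le1P => d v wv.
(* At an interface vertex, the edge of [R] has a counterpart in [L], whose
   image in [D1] would be a second edge besides that of [K]. *)
have mixed x g x' y g' y' : dir_edge d x g x' \in edges R ->
    dir_edge d y g' y' \in edges K -> m2 x' = n2 y' -> False.
  move=> eR eK /(glue_meet glue2) [i ? ?]; subst x' y'.
  have [u' [g1 eL]] := exchange_ifc_edge eR.
  have e1 := hom_dir_edge m1 eL; have e2 := hom_dir_edge n1 eK.
  rewrite (glue_comm glue1) in e1.
  have wk : is_wire (n1 (k i)) by rewrite -(glue_comm glue1) hom_wire ifc_wire.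
  have [mu gg] := deg1 d _ wk _ _ _ _ e1 e2; subst g1.
  exact: exchange_disjoint eL eK mu (glue_comm glue1 i).
move=> u g u' g' /exchange_dir_edge [] [x [x0 [-> vx e]]]
  /exchange_dir_edge [] [x' [x0' [-> vx' e']]].
- have ? : x0 = x0' by apply: (glue_inl glue2); rewrite -vx.
  subst x0'; have wx : is_wire x0 by rewrite -(hom_wire m2) -vx.
  by have [-> ->] := degR d _ wx _ _ _ _ e e'.
- by case: (mixed _ _ _ _ _ _ e e'); rewrite -vx.
- by case: (mixed _ _ _ _ _ _ e' e); rewrite -vx.
- have ? : x0 = x0' by apply: (glue_inr glue2); rewrite -vx.
  subst x0'; have wx : is_wire (n1 x0) by rewrite hom_wire -(hom_wire n2) -vx.
  have [nx ->] := deg1 d _ wx _ _ _ _ (hom_dir_edge n1 e) (hom_dir_edge n1 e').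
  by rewrite (glue_inr glue1 nx).
Qed.

(** An edge at [n2 z] from [K] is also in [D1]; one from [R] sits at an interface vertex, where [L]
    then has an edge of the same direction. *)
Lemma exchange_end d z : wire_end d (n1 z) -> wire_end d (n2 z).
Proof.
move=> /wire_endP [wz ez]; apply/wire_endP; split.
  by move: wz; rewrite !hom_wire.
move=> u g; apply/negP => /exchange_dir_edge [] [x [x' [_ vx e]]].
- have [i ? ?] := glue_meet glue2 (esym vx); subst x' z.
  have [u' [g' /(hom_dir_edge m1)]] := exchange_ifc_edge e.
  by rewrite (glue_comm glue1); apply/negP.
- have /(glue_inr glue2) ? := vx; subst x'.
  by have := hom_dir_edge n1 e; apply/negP.
Qed.

(** An end of [D1] inside the match is already an end of [L], hence a boundary vertex, hence in the
    interface and so also in [K]. *)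
Lemma end_from_K d v : wire_end d v -> exists z, v = n1 z.
Proof.
have [[x ->]|//] := glue_cover glue1 v => /wire_endP [wx ex].
have : wire_end d x.
  apply/wire_endP; split; first by rewrite -(hom_wire m1).
  by move=> u g; apply: contra (ex (m1 u) g); apply: hom_dir_edge.
move/wire_end_boundary; rewrite -l_bnd => /codomP [i ->].
by exists (k i); rewrite (glue_comm glue1).
Qed.

(** Vertices are related when they are images of the same vertex of [K]. Whatever lies outside [K]
    belongs to [L] or [R], both string graphs. *)
Lemma exchange_transfers :
  transfers (fun x y => [exists z, (n1 z == x) && (n2 z == y)]).
Proof.
split.
- by move=> x y /existsP [z /andP[/eqP <- /eqP <-]]; rewrite !hom_lab.
- move=> x y y' /existsP [z /andP[/eqP <- /eqP <-]].
  by case/existsP => z' /andP[/eqP /(glue_inr glue1) -> /eqP <-].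
- move=> x; have [[y ->]|[z ->]] := glue_cover glue1 x.
    by rewrite hom_lab (sg_label sL).
  by move=> _; exists (n2 z); apply/existsP; exists z; rewrite !eqxx.
- move=> v' g w' /(glue_edge glue2) [] [x [x' [-> -> e]]].
    right; rewrite !hom_lab !(sg_label sR) !hom_node; split=> //.
      exact: (sg_edge_label sR e).
    exact: (sg_no_node_edge sR e).
  left; exists (n1 x), (n1 x'); split; last exact: hom_edge.
  + by apply/existsP; exists x; rewrite !eqxx.
  + by apply/existsP; exists x'; rewrite !eqxx.
- move=> s b c y d; rewrite instr2 => /map_instrP [z nz i].
  exists (n1 z); first by apply/existsP; exists z; rewrite nz !eqxx.
  by rewrite instr1; apply/map_instrP; exists z.
- exact: exchange_degree.
- move=> d x ex; have [z ?] := end_from_K ex; subst x.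
  exists (n2 z); first exact: exchange_end.
  by apply/existsP; exists z; rewrite !eqxx.
- move=> d x y y' /existsP [z /andP[/eqP <- /eqP <-]].
  by case/existsP => z' /andP[/eqP /(glue_inr glue1) -> /eqP <-].
Qed.

End Exchange.

(** * From rule applications to the rewrite pattern *)

Lemma transfers_ext (D1 D2 : egraph A) (e e' : D1 -> D2 -> bool) :
  (forall x y, e x y = e' x y) -> transfers e -> transfers e'.
Proof.
move=> ee [h1 h2 h3 h4 h5 h6 h7 h8]; split=> //.
- by move=> x y; rewrite -ee; apply: h1.
- by move=> x y y'; rewrite -!ee; apply: h2.
- by move=> x /h3 [y]; rewrite ee; exists y.
- move=> v g w /h4 [[v0 [w0 []]]|]; last by right.
  by rewrite !ee; left; exists v0, w0.
- by move=> s b c y d /h5 [x]; rewrite ee; exists x.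
- by move=> d x /h7 [y ey]; rewrite ee; exists y.
- by move=> d x y y'; rewrite -!ee; apply: h8.
Qed.

Lemma dpo_similar (G : edNCE A) (rl : span A) (D D' : egraph A)
    (m : hom (sp_lhs rl) D) :
  terminals G = terminalL -> string_graph_rule rl -> injective m ->
  dpo D' m -> similar G D D'.
Proof.
move=> tG sr m_inj [K [k [n [m' [n' [po po' ins ins']]]]]].
(* [n] after [k] equals [m] after [sp_l rl], which is injective. *)
have k_inj : injective k.
  move=> i j kij; apply: (@sp_l_inj _ rl); apply: m_inj.
  have [[comm _] _] := po; have /= -> := comm i; have /= -> := comm j.
  by rewrite kij.
have disc := sgr_discrete sr.
have g1 := pushout_gluing disc (@sp_l_inj _ rl) k_inj po.
have g2 := pushout_gluing disc (@sp_r_inj _ rl) k_inj po'.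
have ends d i : wire_end d (sp_l rl i) = wire_end d (sp_r rl i).
  by case: d; rewrite ?wire_end_input ?wire_end_output;
    [apply: sgr_input|apply: sgr_output].
apply: transfers_similar tG (exchange_transfers (sgr_lhs sr) (sgr_rhs sr)
  (sgr_l sr) ends g1 g2 ins ins') _.
(* The converse transfer is the same lemma with [L] and [R] exchanged; its relation differs only by
   the order of a conjunction. *)
apply: transfers_ext (exchange_transfers (sgr_rhs sr) (sgr_lhs sr)
  (sgr_r sr) (fun d i => esym (ends d i)) g2 g1 ins' ins) => x y.
by apply: eq_existsb => z; rewrite andbC.
Qed.

Lemma rewrites_final_similar (G : edNCE A) Delta (rl : span A)
    (D D' : egraph A) :
  terminals G = terminalL -> string_graph_rule rl ->
  rewrites_final Delta rl D D' -> similar G D D'.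
Proof.
move=> tG sr [S [i [i_inj [Ut [m [_ homeo [_ m_inj _] dp]]]]]].
apply: similar_trans (located_homeo_similar tG homeo) _.
apply: dpo_similar tG sr _ dp => x y /= /loc_inj; exact: m_inj.
Qed.

Lemma BESG_body_ok (B : BESG A) (p : pidx (bgram B)) :
  BESG_grammar B -> body_ok (bgram B) (prhs (prod_of p)).
Proof.
case=> _ [bb bi] _ _ n1 n2 w1 w2 w3 w4.
by split; [exact: bb|exact: bi|exact: n1|exact: n2|
           exact: w1|exact: w2|exact: w3|exact: w4].
Qed.

End Transformation.

Theorem theorem5 (A : alphabet) (B B' : BESG A) (r : span A)
    (p : pidx (bgram B)) (corr : pidx (bgram B) -> pidx (bgram B')) :
  BESG_grammar B ->
  string_graph_rule r ->
  transformation_step r p corr ->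
  rewrite_pattern corr.
Proof.
move=> gB sr [dec ter fin st bij same lhs rhs].
have tG := besg_terminals gB.
have sim q : similar (bgram B) (prhs (prod_of q)) (prhs (prod_of (corr q))).
  have [->|/same ->] := eqVneq q p; last exact: similar_refl.
  exact: rewrites_final_similar tG sr rhs.
have lhsE q : plhs (prod_of (corr q)) = plhs (prod_of q).
  by have [->|/same ->] := eqVneq q p.
have [corr' corrK corrK'] := bij.
(* Each production of [B'] corresponds to one of [B], so similarity carries the conditions over,
   still relative to the grammar of [B]. *)
have ok p' : body_ok (bgram B) (prhs (@prod_of _ (bgram B') p')).
  by rewrite -(corrK' p'); case: (sim (corr' p')) => [[ok _] _ _ _];
    apply/ok/BESG_body_ok.
split=> //; last 2 first.
- by move=> q; case: (sim q).
- by move=> q; case: (sim q).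
split.
- by rewrite dec; apply: besg_dec.
- split=> p'; rewrite ter; [exact: ok_body (ok p')|exact: ok_instr (ok p')].
- by rewrite ter.
- by rewrite fin; apply: besg_finals.
- by move=> p'; apply: ok_N1 (ok p').
- by move=> p'; apply: ok_N2 (ok p').
- by move=> p'; apply: ok_W1 (ok p').
- by move=> p'; apply: ok_W2 (ok p').
- by move=> p'; apply: ok_W3 (ok p').
(* W4 must now be read over the productions of [B']: the instruction is found in the corresponding
   production of [B] and carried back by the last clause of [similar]. *)
- move=> p' y s b d; rewrite ter => ny sW adj q'; rewrite -(corrK' q') lhsE.
  move=> lhsq; have [_ _ _ sg] := sim (corr' q'); apply/sg.
  exact: ok_W4 (ok p') y s b d ny sW adj _ lhsq.
Qed.
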